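(* Let $G$ be a finite group. If $\alpha(G)\ge 1/2$, then $\operatorname{cp}(G)\ge (2\alpha(G)-1)^2$.
   Context: For a finite group $G$, $c(G)$ denotes the number of cyclic subgroups of $G$ (including the trivial one) and $\alpha(G):=c(G)/|G|$. The commuting probability of $G$ is $\operatorname{cp}(G):=|\{(x,y)\in G\times G : xy=yx\}|/|G|^2$. *)

(* Defs.v *)
From mathcomp Require Import all_boot all_order all_algebra all_fingroup.
From mathcomp Require Import all_solvable.

Set Implicit Arguments.
Unset Strict Implicit.
Unset Printing Implicit Defensive.

Local Open Scope ring_scope.

Definition num_cyclic (gT : finGroupType) (G : {group gT}) : nat :=
  #|[set H : {group gT} | (H \subset G) && cyclic H]|.

Definition alpha (gT : finGroupType) (G : {group gT}) : rat :=
  (num_cyclic G)%:R / #|G|%:R.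

Definition commuting_pairs (gT : finGroupType) (G : {group gT})
    : {set gT * gT} :=
  [set xy in setX G G | xy.1 * xy.2 == xy.2 * xy.1]%g.

Definition cp (gT : finGroupType) (G : {group gT}) : rat :=
  #|commuting_pairs G|%:R / #|G|%:R ^+ 2.

(* Main.v *)
Require Import Defs.
From mathcomp Require Import all_boot all_order all_algebra all_fingroup.
From mathcomp Require Import all_solvable.
From mathcomp Require Import lra.

(** Let [I] be the number of solutions of [x ^+ 2 = 1] in [G].  The theorem
    compares both of its sides with [I / #|G|].

    A cyclic subgroup with a generator [x] also has the generator [x^-1], and
    these coincide only when [x ^+ 2 = 1].  Counting one generator and its
    inverse for every cyclic subgroup therefore gives
    [2 * num_cyclic G <= #|G| + I] ([num_cyclic_le]), in other words
    [2 * alpha G - 1 <= I / #|G|].  The hypothesis on [alpha G] makes the left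
    side nonnegative, so this inequality can be squared.

    If [x ^+ 2 = y ^+ 2 = 1], then [x] conjugates [z = x * y] to [z^-1].  The
    elements of [G] that invert a given [z] form either the empty set or a coset
    of the centraliser of [z], so at most [#|'C_G[z]|] pairs [(x, y)] have
    product [z].  Summing over [z] yields [I ^ 2 <= #|commuting_pairs G|]
    ([sqr_card_sqroots1_le]), in other words [(I / #|G|) ^+ 2 <= cp G]. *)

Set Implicit Arguments.
Unset Strict Implicit.
Unset Printing Implicit Defensive.

Local Open Scope ring_scope.

Import Order.TTheory GRing.Theory Num.Theory.

Definition sqroots1 (gT : finGroupType) (G : {group gT}) : {set gT} :=
  [set x in G | x ^+ 2 == 1]%g.

(** If [x] and [y] generate the chosen cyclic subgroups [H] and [K] and
    [x = y^-1], then [H = K], hence [x = y] and [x ^+ 2 = 1]: the set of chosen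
    generators meets the set of their inverses inside [sqroots1 G]. *)
Lemma num_cyclic_le (gT : finGroupType) (G : {group gT}) :
  (num_cyclic G + num_cyclic G <= #|G| + #|sqroots1 G|)%N.
Proof.
rewrite /num_cyclic; set C := [set H : {group gT} | _].
pose gen (H : {group gT}) : gT := odflt 1%g [pick x | <[x]>%g == H :> {set gT}].
have genK H : H \in C -> <[gen H]>%g = H :> {set gT}.
  rewrite inE /gen => /andP[_ /cyclicP[x defH]].
  by case: pickP => [y /eqP // | /(_ x)]; rewrite -defH eqxx.
have gen_inj : {in C &, injective gen}.
  by move=> H K CH CK eqg; apply: val_inj; rewrite /= -(genK H) // -(genK K) // eqg.
have genG H : H \in C -> gen H \in G.
  move=> CH; have := CH; rewrite inE => /andP[/subsetP sHG _].
  by apply: sHG; rewrite -(genK H CH) cycle_id.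
have cardV : #|[set (gen H)^-1 | H in C]%g| = #|C|.
  by apply: card_in_imset => H K CH CK /invg_inj; apply: gen_inj.
rewrite -{1}(card_in_imset gen_inj) -cardV -cardsUI; apply: leq_add.
  apply/subset_leq_card/subsetP=> x /setUP[] /imsetP[H CH ->]; last rewrite groupV.
    exact: genG.
  exact: genG.
apply/subset_leq_card/subsetP=> x /setIP[/imsetP[H CH ->] /imsetP[K CK eqg]].
have eqHK : H = K.
  by apply: val_inj; rewrite /= -(genK H) // -(genK K) // eqg cycleV.
by rewrite inE genG //= expgS expg1 {2}eqg eqHK mulgV.
Qed.

(** The coset argument is carried out as one injection into the commuting pairs.
    Choosing a base point [inverter z] in the coset of elements inverting
    [z = x * y] turns [x] into [x * (inverter z)^-1], a product of two inverters
    of [z], hence an element that commutes with [z]; from it and [z] one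
    recovers [x], then [y]. *)
Lemma sqr_card_sqroots1_le (gT : finGroupType) (G : {group gT}) :
  (#|sqroots1 G| ^ 2 <= #|commuting_pairs G|)%N.
Proof.
rewrite expnS expn1 -cardsX.
pose inverter (z : gT) : gT := odflt 1%g [pick r in G | z ^ r == z^-1]%g.
pose f (p : gT * gT) := (p.1 * p.2, p.1 * (inverter (p.1 * p.2))^-1)%g.
have f_inj : injective f.
  move=> [x y] [x' y'] [/= eqz]; rewrite eqz => /mulIg eqx.
  by move: eqz; rewrite eqx => /mulgI ->.
rewrite -(card_imset _ f_inj); apply/subset_leq_card/subsetP=> _ /imsetP[[x y] xy_in ->].
move: xy_in; rewrite !inE /= => /andP[/andP[Gx /eqP x2] /andP[Gy /eqP y2]].
have xV : (x^-1 = x)%g by apply/eqP; rewrite eq_invg_mul -[(_ * _)%g]/(x ^+ 2)%g x2.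
have yV : (y^-1 = y)%g by apply/eqP; rewrite eq_invg_mul -[(_ * _)%g]/(y ^+ 2)%g y2.
rewrite /f /=; set z := (x * y)%g.
have zx : (z ^ x = z^-1)%g by rewrite /z conjgE invMg -mulgA mulKg xV yV.
have [Gr zr] : inverter z \in G /\ (z ^ inverter z = z^-1)%g.
  rewrite /inverter; case: pickP => [r /andP[Gr /eqP zr] // | /(_ x)].
  by rewrite Gx zx eqxx.
rewrite !groupM ?groupV //=; apply/eqP/commgP/conjg_fixP.
by rewrite conjgM zx -zr conjgK.
Qed.

Theorem lemma2 (gT : finGroupType) (G : {group gT}) :
  1 / 2 <= alpha G -> (2 * alpha G - 1) ^+ 2 <= cp G.
Proof.
move=> alpha_ge.
have G_gt0 : 0 < #|G|%:R :> rat by rewrite ltr0n cardG_gt0.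
have alpha_le : 2 * alpha G - 1 <= #|sqroots1 G|%:R / #|G|%:R.
  have := num_cyclic_le G; rewrite -(ler_nat rat) !natrD => le_c.
  rewrite ler_pdivlMr // mulrBl mul1r -mulrA /alpha divfK ?gt_eqF //.
  by lra.
apply: (@le_trans _ _ ((#|sqroots1 G|%:R / #|G|%:R) ^+ 2)).
  by rewrite lerXn2r ?nnegrE //; lra.
rewrite expr_div_n /cp ler_pM2r ?invr_gt0 ?exprn_gt0 //.
by rewrite -natrX ler_nat sqr_card_sqroots1_le.
Qed.
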